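(* Let $f:\mathbb{R}^n\to\mathbb{R}$ be continuously differentiable, and let vectors $\bm{x}\in\mathbb{R}^n$ be partitioned into $p$ blocks, $\bm{x}=(\bm{x}_1^\top,\dots,\bm{x}_p^\top)^\top$ with $\bm{x}_i\in\mathbb{R}^{n_i}$ and $n_1+\dots+n_p=n$. Define $\nabla_{\mathrm d} f:\mathbb{R}^n\times\mathbb{R}^n\to\mathbb{R}^n$ blockwise by $$(\nabla_{\mathrm d} f(\bm{x},\bm{y}))_i=\int_0^1\nabla_i f(\bm{x}_1,\dots,\bm{x}_{i-1},\,\xi\bm{x}_i+(1-\xi)\bm{y}_i,\,\bm{y}_{i+1},\dots,\bm{y}_p)\,\mathrm{d}\xi,\qquad i=1,\dots,p,$$ where the subscript $i$ denotes the $i$th block and $\nabla_i$ denotes the gradient with respect to the $i$th block. Then $\nabla_{\mathrm d} f$ is a discrete gradient of $f$, i.e. for all $\bm{x},\bm{y}\in\mathbb{R}^n$, $$f(\bm{x})-f(\bm{y})=\nabla_{\mathrm d} f(\bm{x},\bm{y})^\top(\bm{x}-\bm{y})\qquad\text{and}\qquad \nabla_{\mathrm d} f(\bm{x},\bm{x})=\nabla f(\bm{x}).$$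
   Context: For a continuously differentiable $f:\mathbb{R}^n\to\mathbb{R}$, a function $\nabla_{\mathrm d} f:\mathbb{R}^n\times\mathbb{R}^n\to\mathbb{R}^n$ is called a discrete gradient if $f(\bm{x})-f(\bm{y})=\nabla_{\mathrm d} f(\bm{x},\bm{y})^\top(\bm{x}-\bm{y})$ and $\nabla_{\mathrm d} f(\bm{x},\bm{x})=\nabla f(\bm{x})$ for all $\bm{x},\bm{y}\in\mathbb{R}^n$. *)

(* Defs.v *)
From HB Require Import structures.
From mathcomp Require Import all_boot all_order all_algebra.
From mathcomp Require Import all_classical all_reals all_analysis.

Set Implicit Arguments.
Unset Strict Implicit.
Unset Printing Implicit Defensive.

Import Order.TTheory GRing.Theory Num.Theory.
Import numFieldNormedType.Exports.

Local Open Scope classical_set_scope.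
Local Open Scope ring_scope.

Definition gradient (R : realType) (n : nat) (f : 'cV[R]_n -> R)
    (x : 'cV[R]_n) : 'cV[R]_n :=
  \col_i 'D_(delta_mx i 0) f x.

Definition continuously_differentiable (R : realType) (n : nat)
    (f : 'cV[R]_n -> R) : Prop :=
  (forall x, differentiable f x) /\ continuous (gradient f).

(* The 1 x 1 matrix u^T v is read as a scalar through its only entry. *)
Definition is_discrete_gradient (R : realType) (n : nat)
    (f : 'cV[R]_n -> R) (g : 'cV[R]_n -> 'cV[R]_n -> 'cV[R]_n) : Prop :=
  (forall x y, f x - f y = ((g x y)^T *m (x - y)) 0 0) /\
  (forall x, g x x = gradient f x).

(* [n_ i] is the size of block [i], so the whole space is R^(n_1 + ... + n_p);
   block [i] of [x] is [submxcol x i].  The gradient with respect to block [i]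
   is that of the function of block [i] alone, the other blocks being frozen. *)
Definition block_gradient (R : realType) (p : nat) (n_ : 'I_p -> nat)
    (f : 'cV[R]_(\sum_(i < p) n_ i) -> R) (i : 'I_p)
    (z : 'cV[R]_(\sum_(i < p) n_ i)) : 'cV[R]_(n_ i) :=
  gradient (fun u : 'cV[R]_(n_ i) => f (\mxcol_j dfwith (submxcol z) i u j))
    (submxcol z i).

(* (x_1, ..., x_(i-1), xi x_i + (1 - xi) y_i, y_(i+1), ..., y_p) *)
Definition block_path (R : realType) (p : nat) (n_ : 'I_p -> nat)
    (x y : 'cV[R]_(\sum_(i < p) n_ i)) (i : 'I_p) (xi : R) :
    'cV[R]_(\sum_(i < p) n_ i) :=
  \mxcol_(j < p)
    (if (j < i)%N then submxcol x j
     else if j == i then xi *: submxcol x j + (1 - xi) *: submxcol y j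
     else submxcol y j).

(* The vector-valued integral is taken entrywise. *)
Definition block_discrete_gradient (R : realType) (p : nat) (n_ : 'I_p -> nat)
    (f : 'cV[R]_(\sum_(i < p) n_ i) -> R)
    (x y : 'cV[R]_(\sum_(i < p) n_ i)) : 'cV[R]_(\sum_(i < p) n_ i) :=
  \mxcol_(i < p) \col_(k < n_ i)
    \int[@lebesgue_measure R]_(xi in `[0, 1])
      (block_gradient f i (block_path x y i xi) k 0).

(* Main.v *)
(* The points w_m = (x_1, ..., x_m, y_(m+1), ..., y_p) interpolate between y and
   x, and the i-th block path is the segment from w_(i-1) to w_i.  By the
   fundamental theorem of calculus f (w_i) - f (w_(i-1)) is the i-th block of the
   discrete gradient paired with x_i - y_i; these increments telescope to
   f x - f y.  When x = y every path is constant. *)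
Require Import Defs.
From mathcomp Require Import all_boot all_order all_algebra.
From mathcomp Require Import all_classical all_reals all_analysis.

Section Gradient.
Import Order.TTheory GRing.Theory Num.Theory.
Import numFieldNormedType.Exports.
Local Open Scope classical_set_scope.
Local Open Scope ring_scope.

(** Both difference quotients are the same function of [h], so no chain rule is needed. It serves
    for segments in [segment_increment] and for the insertion of one block in [block_gradientE]. *)
Lemma derivative_along_affine (R : realType) (U V : normedModType R)
    (f : V -> R) (g : U -> V) (u v : U) (e : V) :
  (forall h : R, g (h *: v + u) = h *: e + g u) ->
  'D_v (f \o g) u = 'D_e f (g u) /\
  (derivable f (g u) e -> derivable (f \o g) u v).
Proof.
move=> gE; rewrite /derive /derivable.
have quotE : (fun h : R =>
      h^-1 *: (((f \o g) \o shift u) (h *: v) - (f \o g) u)) =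
    (fun h => h^-1 *: ((f \o shift (g u)) (h *: e) - f (g u))).
  by apply/funext => h; rewrite /= gE.
by rewrite quotE.
Qed.

Lemma derive_gradient (R : realType) (n : nat) (f : 'cV[R]_n -> R)
    (z v : 'cV[R]_n) :
  differentiable f z -> 'D_v f z = \sum_s gradient f z s 0 * v s 0.
Proof.
move=> df; rewrite deriveE// [in LHS](matrix_sum_delta v) linear_sum.
apply: eq_bigr => s _; rewrite big_ord1 linearZ /= mxE deriveE//.
by rewrite mulrC.
Qed.

Lemma segment_continuous (R : realType) (n : nat) (a v : 'cV[R]_n) :
  continuous (fun t : R => a + t *: v).
Proof.
by move=> t; apply: cvgD; [exact: cvg_cst | apply: cvgZr_tmp; exact: cvg_id].
Qed.

Lemma gradient_segment_continuous (R : realType) (n : nat)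
    (f : 'cV[R]_n -> R) (a v : 'cV[R]_n) (s : 'I_n) :
  continuous (gradient f) ->
  continuous (fun t : R => gradient f (a + t *: v) s 0).
Proof.
move=> cf t.
apply: (@continuous_comp _ _ _ (fun t : R => gradient f (a + t *: v))
  (fun M : 'cV[R]_n => M s 0)); last exact: coord_continuous.
apply: (@continuous_comp _ _ _ (fun t : R => a + t *: v) (gradient f)).
  exact: segment_continuous.
exact: cf.
Qed.

Lemma Rintegral_sum_continuous (R : realType) (n : nat) (h : 'I_n -> R -> R) :
  (forall s, continuous (h s)) ->
  \int[@lebesgue_measure R]_(t in `[0, 1]) (\sum_s h s t) =
  \sum_s \int[@lebesgue_measure R]_(t in `[0, 1]) h s t.
Proof.
have int01 (g : R -> R) : continuous g ->
    (@lebesgue_measure R).-integrable `[0, 1] (EFin \o g).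
  move=> cg; apply: continuous_compact_integrable; first exact: segment_compact.
  exact: continuous_subspaceT.
elim: n h => [|n IHn] h ch.
  rewrite big_ord0; under eq_Rintegral do rewrite big_ord0.
  by rewrite Rintegral_cst// mul0r.
rewrite big_ord_recl -IHn//.
under eq_Rintegral do rewrite big_ord_recl.
rewrite RintegralD//; apply: int01 => //.
by apply: continuous_big => [|s _]; [exact: add_continuous | exact: ch].
Qed.

(** The fundamental theorem of calculus for [F t = f (a + t *: v)], whose derivative [g] is the
    gradient paired with [v]. *)
Lemma segment_increment (R : realType) (n : nat) (f : 'cV[R]_n -> R)
    (a v : 'cV[R]_n) :
  continuously_differentiable f ->
  f (a + v) - f a =
  \sum_s (\int[@lebesgue_measure R]_(t in `[0, 1])
            gradient f (a + t *: v) s 0) * v s 0.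
Proof.
move=> [df cf].
pose g (t : R) := \sum_s gradient f (a + t *: v) s 0 * v s 0.
pose F (t : R) := f (a + t *: v).
have cgs s : continuous (fun t : R => gradient f (a + t *: v) s 0 * v s 0).
  move=> t; apply: cvgM; last exact: cvg_cst.
  exact: gradient_segment_continuous.
have cg : continuous g.
  by apply: continuous_big => [|s _]; [exact: add_continuous | exact: cgs].
have dF t : 'D_1 F t = g t /\ derivable F t 1.
  (* The real line is taken as a normed module with direction [1]; a step [h] in [t] moves the point
     by [h *: v]. *)
  have affE (h : R) : a + (h *: (1 : R) + t) *: v = h *: v + (a + t *: v).
    by rewrite scalerDl addrCA /GRing.scale/= mulr1.
  have [DF dF] := derivative_along_affine _ _ _ f
    (fun t : R => a + t *: v) t 1 v affE.
  split; first by rewrite DF derive_gradient.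
  by apply: dF; exact: diff_derivable.
have cF : continuous F.
  by move=> t; apply/differentiable_continuous/derivable1_diffP; case: (dF t).
have FTC : (\int[@lebesgue_measure R]_(t in `[0%R, 1%R]) (g t)%:E =
            (F 1)%:E - (F 0)%:E)%E.
  apply: continuous_FTC2 => //.
  - exact: continuous_subspaceT.
  - split; first by move=> t _; case: (dF t).
    + by apply: cvg_at_right_filter; exact: cF.
    + by apply: cvg_at_left_filter; exact: cF.
  - by move=> t _; rewrite derive1E; case: (dF t).
have -> : f (a + v) - f a = \int[@lebesgue_measure R]_(t in `[0, 1]) g t.
  by rewrite /Rintegral FTC /F scale1r scale0r addr0.
rewrite Rintegral_sum_continuous//; apply: eq_bigr => s _.
rewrite RintegralZr//; apply: continuous_compact_integrable.
  exact: segment_compact.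
by apply: continuous_subspaceT; exact: gradient_segment_continuous.
Qed.

End Gradient.

Section Blocks.
Import Order.TTheory GRing.Theory Num.Theory.
Import numFieldNormedType.Exports.
Local Open Scope classical_set_scope.
Local Open Scope ring_scope.
Import tagnat.
Variables (R : realType) (p : nat) (n_ : 'I_p -> nat).
Local Notation n := (\sum_(i < p) n_ i)%N.
Implicit Types (f : 'cV[R]_n -> R) (x y z : 'cV[R]_n).

(** Moving entry [k] of block [i] with the other blocks frozen moves [z] along the basis vector of
    global index [Rank i k], so the partial derivatives agree. *)
Lemma block_gradientE f (i : 'I_p) z (k : 'I_(n_ i)) :
  block_gradient f i z k 0 = gradient f z (Rank i k) 0.
Proof.
rewrite /block_gradient !mxE.
pose g (u : 'cV[R]_(n_ i)) : 'cV[R]_n := \mxcol_j dfwith (submxcol z) i u j.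
have gz : g (submxcol z i) = z.
  apply/mxcolP => j; rewrite mxcolK.
  by case: dfwithP.
have affE (h : R) : g (h *: delta_mx k 0 + submxcol z i) =
    h *: delta_mx (Rank i k) 0 + g (submxcol z i).
  rewrite gz; apply/mxcolP => j; rewrite mxcolK.
  (* Inside block [i] the global and local basis vectors have the same entries; in any other block
     the global one vanishes. *)
  case: dfwithP => [|j' ij']; apply/matrixP => l m; rewrite !mxE -!val_eqE /=.
    by rewrite eq_Rank eqxx.
  by rewrite eq_Rank eq_sym (negbTE ij') /= mulr0 add0r.
have [Dg _] := derivative_along_affine _ _ _ f g _ _ _ affE.
by rewrite gz in Dg.
Qed.

(** [sig1 s] is the block containing coordinate [s]; from here on arguments run over global
    coordinates, free of the dependent block sizes. *)
Lemma block_pathE x y (i : 'I_p) (t : R) (s : 'I_n) :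
  block_path x y i t s 0 =
  if (sig1 s < i)%N then x s 0
  else if sig1 s == i then t * x s 0 + (1 - t) * y s 0 else y s 0.
Proof.
by rewrite /block_path !mxE; do 2?case: ifP => _; rewrite !mxE sig2K.
Qed.

Lemma block_discrete_gradientE f x y (s : 'I_n) :
  block_discrete_gradient f x y s 0 =
  \int[@lebesgue_measure R]_(t in `[0, 1])
    gradient f (block_path x y (sig1 s) t) s 0.
Proof.
rewrite /block_discrete_gradient !mxE.
by apply: eq_Rintegral => t _; rewrite block_gradientE sig2K.
Qed.

Lemma block_discrete_gradient_diag f x :
  block_discrete_gradient f x x = gradient f x.
Proof.
apply/matrixP => s j; rewrite ord1 block_discrete_gradientE.
have path_cst i t : block_path x x i t = x.
  apply/matrixP => r m; rewrite ord1 block_pathE; do 2?case: ifP => // _.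
  by rewrite -mulrDl addrC subrK mul1r.
under eq_Rintegral do rewrite path_cst.
by rewrite Rintegral_cst//= lebesgue_measure_itv/= lte01 oppr0 adde0 mulr1.
Qed.

(** The point w_m. Blocks are numbered from 0, so the path of block [i] runs from w_i to w_(i+1);
    [m] is a natural number because it must also reach [p]. *)
Definition block_interpolant x y (m : nat) : 'cV[R]_n :=
  \col_s (if (sig1 s < m)%N then x s 0 else y s 0).

(** Zero padding makes the displacement of one block a vector of the whole space, to which
    [segment_increment] applies. *)
Definition block_restrict z (i : 'I_p) : 'cV[R]_n :=
  \col_s (if sig1 s == i then z s 0 else 0).

Lemma block_path_segment x y (i : 'I_p) (t : R) :
  block_path x y i t =
  block_interpolant x y i + t *: block_restrict (x - y) i.
Proof.
apply/matrixP => s j; rewrite ord1 block_pathE !mxE.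
case: eqP => [->|_]; last by case: ifP => _; rewrite mulr0 addr0.
by rewrite ltnn mulrBl mul1r mulrBr addrCA.
Qed.

Lemma block_interpolantS x y (i : 'I_p) :
  block_interpolant x y i.+1 =
  block_interpolant x y i + block_restrict (x - y) i.
Proof.
apply/matrixP => s j; rewrite ord1 !mxE ltnS leq_eqVlt val_eqE.
by case: eqP => [->|_] /=; rewrite ?ltnn ?addr0// addrC subrK.
Qed.

Lemma block_interpolant_increment f x y (i : 'I_p) :
  continuously_differentiable f ->
  f (block_interpolant x y i.+1) - f (block_interpolant x y i) =
  \sum_(s | sig1 s == i) block_discrete_gradient f x y s 0 * (x - y) s 0.
Proof.
(* Both sides become sums over all coordinates; those outside block [i] contribute zero. *)
move=> hf; rewrite block_interpolantS segment_increment// [RHS]big_mkcond.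
apply: eq_bigr => s _; rewrite [block_restrict _ _ _ _]mxE.
case: eqP => [si|_]; last by rewrite mulr0.
rewrite (block_discrete_gradientE f x y s) si.
by under [in RHS]eq_Rintegral do rewrite block_path_segment.
Qed.

Lemma block_discrete_gradient_increment f x y :
  continuously_differentiable f ->
  f x - f y = \sum_s block_discrete_gradient f x y s 0 * (x - y) s 0.
Proof.
(* Coordinates are grouped by block, so that each inner sum is one increment of the telescope. *)
move=> hf; rewrite (partition_big (@sig1 _ _) xpredT)//=.
under eq_bigr do rewrite -block_interpolant_increment//.
rewrite -(big_mkord xpredT (fun i => f (block_interpolant x y i.+1) -
  f (block_interpolant x y i))) telescope_sumr//.
(* The ends are w_p = x, as every block index is below [p], and w_0 = y. *)
by congr (f _ - f _); apply/matrixP => s j; rewrite ord1 mxE ?ltn_ord.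
Qed.

End Blocks.

Theorem proposition3 (R : realType) (p : nat) (n_ : 'I_p -> nat)
    (f : 'cV[R]_(\sum_(i < p) n_ i) -> R)
    (hf : continuously_differentiable f) :
  is_discrete_gradient f (block_discrete_gradient f).
Proof.
split=> [x y|x]; last exact: block_discrete_gradient_diag.
rewrite block_discrete_gradient_increment// [RHS]mxE.
by apply: eq_bigr => s _; rewrite [in RHS]mxE.
Qed.
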